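(* For every negative integer $-t$ (that is, for every positive integer $t$) and every $\epsilon>0$, there exists a positive integer $N$ such that if $n>N$, then the polynomial $D_n(x)$ has a root $x_t$ satisfying $|-t-x_t|<\epsilon$.
   Context: A derangement is a permutation with no fixed points (no cycles of length 1). For a positive integer $n$, $d(n,k)$ denotes the number of derangements of length $n$ (i.e. of $\{1,\dots,n\}$) with exactly $k$ cycles, and $D_n(x)=\sum_{k=1}^{\lfloor n/2\rfloor} d(n,k)x^k$. It is a previously known result (Brenti) that all roots of $D_n(x)$ are real and non-positive. *)

(* Defs.v *)
From mathcomp Require Import all_boot all_order all_algebra all_fingroup.

Set Implicit Arguments.
Unset Strict Implicit.
Unset Printing Implicit Defensive.

Import GRing.Theory.

Local Open Scope ring_scope.

Definition derangement (n : nat) (s : 'S_n) : bool := [forall i, s i != i].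

(* [porbits s] is the set of all cycles of [s], including those of length 1. *)
Definition derangement_count (n k : nat) : nat :=
  #|[set s : 'S_n | derangement s & #|porbits s| == k]|.

Definition derangement_poly (R : nzRingType) (n : nat) : {poly R} :=
  \sum_(1 <= k < (n./2).+1) (derangement_count n k)%:R *: 'X^k.

(* Main.v *)
(* Multiplying by transpositions gives
     \sum_s x ^ cycles(s) = x ^ (n - |A|) * x (x + 1) ... (x + |A| - 1)
   over the permutations s supported on A, so inclusion-exclusion on the fixed
   points yields, with p_m = (-y) (1 - y) ... (m - 1 - y),
     D_n(-y) = \sum_J y ^ (n - |J|) p_|J| over the subsets J of {1, ..., n}.
   If K < y < K + 1, every p_m with m > K has the sign (-1) ^ (K + 1), and
   |p_n| outgrows the sum of the terms with |J| <= K, so D_n(-y) has that sign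
   for n large. Hence D_n takes opposite signs at -t - d and -t + d. *)
Require Import Defs.
From mathcomp Require Import all_boot all_order all_algebra all_fingroup.
From mathcomp Require Import reals.

Set Implicit Arguments.
Unset Strict Implicit.
Unset Printing Implicit Defensive.

Import Order.TTheory GRing.Theory Num.Theory.

Local Open Scope ring_scope.

Lemma partition_porbits (T : finType) (s : {perm T}) :
  partition (porbits s) [set: T].
Proof.
have /orbit_partition : [acts <[s]>%G, on [set: T] | 'P].
  apply/subsetP => u _; rewrite !inE /=; apply/subsetP => x _.
  by rewrite !inE.
congr (partition _ _); apply/setP => B.
by apply/imsetP/imsetP => -[x _ ->]; exists x; rewrite ?inE // unlock.
Qed.

(** Every cycle of a derangement contains two distinct points, [i] and [s i]. Hence cutting the
    polynomial off at degree [n./2] loses nothing. *)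
Lemma porbits_derangement_leq (n : nat) (s : 'S_n) :
  derangement s -> (#|porbits s| <= n./2)%N.
Proof.
move=> /forallP der_s.
rewrite geq_half_double -[X in (_ <= X)%N]card_ord -cardsT.
rewrite (card_partition (partition_porbits s)).
rewrite -muln2 -sum_nat_const leq_sum // => _ /imsetP[i _ ->].
apply: leq_trans (_ : #|[set i; s i]| <= _)%N.
  by rewrite cards2 eq_sym der_s.
apply/subset_leq_card/subsetP => j; rewrite !inE => /orP[] /eqP ->.
  exact: porbit_id.
by have := mem_porbit s 1 i; rewrite expg1.
Qed.

Lemma porbits_gt0 (T : finType) (s : {perm T}) (x : T) : (0 < #|porbits s|)%N.
Proof. by apply/card_gt0P; exists (porbit s x); apply: imset_f. Qed.

Lemma card_porbits1 (T : finType) : #|porbits (1%g : {perm T})| = #|T|.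
Proof.
rewrite card_imset // => x y /eqP; rewrite eq_porbit_mem => /porbitP[i].
by rewrite expg1n perm1.
Qed.

(** [tperm a b * s] sends [b] to [s a], so it sends [b] to [a] exactly when [s] fixes [a]. This
    sorts the permutations of [A] by the preimage of [a]. *)
Lemma perm_on_fix (T : finType) (A : {set T}) (a b : T) (s : {perm T}) :
  a \in A -> b \in A ->
  perm_on A (tperm a b * s)%g && ((tperm a b * s)^-1%g a == b) =
  perm_on (A :\ a) s.
Proof.
move=> aA bA.
have on_t : perm_on A (tperm a b).
  apply/subsetP => x; apply: contraR => xA.
  by rewrite tpermD //; apply: contraNneq xA => <-.
rewrite -(inj_eq (@perm_inj _ (tperm a b * s)%g)) permKV permM tpermR.
apply/andP/idP => [[on_ts /eqP sa]|on_s].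
  have on_s : perm_on A s.
    by rewrite -[s](mulKg (tperm a b)) perm_onM // perm_onV.
  apply/subsetP => x sx; rewrite !inE (subsetP on_s) // andbT.
  by apply: contraNneq sx => ->; rewrite -sa.
split; last by rewrite (out_perm on_s) // !inE eqxx.
rewrite perm_onM //; apply: subset_trans on_s _; exact: subsetDl.
Qed.

Lemma sum_perm_on_porbits (R : idomainType) (x : R) (T : finType)
    (A : {set T}) : x != 0 ->
  \sum_(s : {perm T} | perm_on A s) x ^+ #|porbits s| =
  x ^+ (#|T| - #|A|) * \prod_(i < #|A|) (x + i%:R).
Proof.
move=> x0; move: {2}#|A| (erefl #|A|) => m; elim: m A => [|m IHm] A cardA.
  have {cardA} -> : A = set0 by apply/eqP; rewrite -cards_eq0 cardA.
  rewrite cards0 big_ord0 mulr1 subn0 (big_pred1 1%g) ?card_porbits1 // => s.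
  apply/idP/eqP => [on_s|->]; last exact: perm_on1.
  by apply: (perm_on_id on_s); rewrite cards0.
have /card_gt0P[a aA] : (0 < #|A|)%N by rewrite cardA.
have cardB : #|A :\ a| = m by have := cardsD1 a A; rewrite aA cardA => -[].
rewrite (partition_big (fun s : {perm T} => s^-1%g a) (fun b => b \in A));
  last first.
  by move=> s /perm_onV /perm_closed ->.
(* For [b != a], the transposition merges the fixed point [a] of [s] into the cycle of [b], losing
   one cycle; the factor [x] makes up for it without a division. *)
have summand b : b \in A ->
    x * \sum_(s : {perm T} | perm_on A s && (s^-1%g a == b)) x ^+ #|porbits s| =
    (if b == a then x else 1) *
    \sum_(s : {perm T} | perm_on (A :\ a) s) x ^+ #|porbits s|.
  move=> bA; rewrite (reindex_inj (mulgI (tperm a b))).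
  under eq_bigl => s do rewrite perm_on_fix //.
  rewrite !mulr_sumr; apply: eq_bigr => s on_s.
  have [->|neq_ba] := eqVneq b a; first by rewrite tperm1 mul1g.
  have sa : s a = a by rewrite (out_perm on_s) // !inE eqxx.
  have a_notin : a \notin porbit s b.
    apply: contraNN neq_ba; rewrite porbit_sym => /porbitP[i ->].
    by elim: i => [|i IHi]; rewrite ?perm1 // expgSr permM (eqP IHi) sa.
  have := porbits_mul_tperm s a b.
  rewrite /= a_notin eq_sym neq_ba /= addn2 addn1 => -[<-].
  by rewrite mul1r -exprS.
apply: (mulfI x0); rewrite mulr_sumr (eq_bigr _ summand) -mulr_suml.
rewrite (IHm _ cardB) cardB cardA big_ord_recr /= (bigD1 a) //= eqxx.
rewrite (eq_bigr (fun=> 1)); last by move=> b /andP[_ /negPf ->].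
rewrite sumr_const.
have -> : #|[pred i | i \in A & i != a]| = m.
  by rewrite -cardB; apply: eq_card => b; rewrite !inE andbC.
have ltmT : (m < #|T|)%N by rewrite -cardA max_card.
by rewrite -(subnSK ltmT) exprS mulrC !mulrA.
Qed.

Lemma horner_derangement_poly (R : comNzRingType) (n : nat) (x : R) :
  (0 < n)%N ->
  (derangement_poly R n).[x] =
  \sum_(s : 'S_n | derangement s) x ^+ #|porbits s|.
Proof.
move=> n0; rewrite /derangement_poly horner_sum.
transitivity (\sum_(1 <= k < (n./2).+1)
    \sum_(s : 'S_n | derangement s) if k == #|porbits s| then x ^+ k else 0).
  apply: eq_bigr => k _; rewrite hornerZ hornerXn -big_mkcondr /=.
  rewrite sumr_const mulr_natl /derangement_count; congr (_ *+ _).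
  by apply: eq_card => s; rewrite !inE eq_sym.
rewrite exchange_big; apply: eq_bigr => s der_s.
rewrite -big_mkcond big_nat1_eq ltnS porbits_derangement_leq //.
by rewrite (porbits_gt0 _ (Ordinal n0)).
Qed.

(* Inclusion-exclusion; [J] is the complement of a set of prescribed fixed
   points. *)
Lemma sum_derangement_porbits (R : idomainType) (n : nat) (x : R) : x != 0 ->
  \sum_(s : 'S_n | derangement s) x ^+ #|porbits s| =
  \sum_(J : {set 'I_n}) (- x) ^+ (n - #|J|) * \prod_(i < #|J|) (x + i%:R).
Proof.
move=> x0.
have der_expand (s : 'S_n) :
    (if derangement s then x ^+ #|porbits s| else 0) =
    \sum_(J : {set 'I_n})
      if perm_on J s then (-1) ^+ #|~: J| * x ^+ #|porbits s| else 0.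
  (* The indicator of derangements is the product of [1 - [s i = i]] up to sign. In its expansion
     the term of [J] survives iff [s] fixes every point outside [J]. *)
  have -> : (if derangement s then x ^+ #|porbits s| else 0) =
      \prod_i ((if s i == i then -1 else 0) + 1) * x ^+ #|porbits s|.
    case: ifPn => [/forallP der_s|].
      by rewrite big1 ?mul1r // => i _; rewrite (negPf (der_s i)) add0r.
    rewrite negb_forall => /existsP[i]; rewrite negbK => si.
    by rewrite (bigD1 i) //= si addNr !mul0r.
  rewrite bigA_distr mulr_suml (reindex_inj (@setC_inj _)) /=.
  apply: eq_bigr => J _; case: ifPn => [on_s|].
    congr (_ * _); rewrite -big_mkcond /= -prodr_const.
    by apply: eq_bigr => i; rewrite inE => iJ; rewrite (out_perm on_s) ?eqxx.
  move=> /subsetPn[i]; rewrite inE => si iJ.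
  by rewrite (bigD1 i) //= inE iJ (negPf si) !mul0r.
rewrite big_mkcond (eq_bigr _ (fun s _ => der_expand s)) exchange_big /=.
apply: eq_bigr => J _; rewrite -big_mkcond -mulr_sumr sum_perm_on_porbits //.
by rewrite mulrA [#|~: J|]cardsCs setCK card_ord -exprMn mulN1r.
Qed.

(** From [M] on, the ratio [u n / q ^+ n] at least doubles at each step, so it passes any
    constant. *)
Lemma geometric_lt_eventually (R : archiRealFieldType) (u : nat -> R)
    (q C : R) (M : nat) : 0 < q -> 0 <= C -> 0 < u M ->
  (forall n, (M <= n)%N -> 2 * q * u n <= u n.+1) ->
  exists N : nat, forall n, (N <= n)%N -> C * q ^+ n < u n.
Proof.
move=> q0 C0 uM0 u_step.
have u_ge k : (2 * q) ^+ k * u M <= u (k + M)%N.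
  elim: k => [|k IHk]; first by rewrite mul1r.
  apply: le_trans (u_step _ (leq_addl _ _)).
  by rewrite exprS -mulrA ler_wpM2l // mulr_ge0 // ltW.
have B0 : 0 <= C * q ^+ M / u M.
  by rewrite divr_ge0 ?mulr_ge0 ?exprn_ge0 // ltW.
exists (Num.bound (C * q ^+ M / u M) + M)%N => n le_n.
have le_Mn : (M <= n)%N by apply: leq_trans le_n; exact: leq_addl.
rewrite -(subnK le_Mn); set k := (n - M)%N.
apply: lt_le_trans (u_ge k).
rewrite exprD exprMn mulrCA [2 ^+ k * _]mulrC -mulrA ltr_pM2l ?exprn_gt0 //.
rewrite -ltr_pdivrMr //; apply: lt_trans (archi_boundP B0) _.
rewrite -natrX ltr_nat; apply: leq_ltn_trans (ltn_expl k (ltnSn 1)).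
by rewrite leq_subRL // addnC.
Qed.

(* Up to sign, the full set contributes [p n], which grows factorially, whereas
   the summands of the wrong sign ([#|J| <= K]) grow at most geometrically. *)
Lemma derangement_poly_sign (R : archiRealFieldType) (K : nat) (y : R) :
  K%:R < y < K.+1%:R ->
  exists N : nat, forall n, (N < n)%N ->
    0 < (-1) ^+ K.+1 * (derangement_poly R n).[- y].
Proof.
move=> /andP[ltKy ltyK].
have y0 : 0 < y by apply: le_lt_trans ltKy.
pose p m := (-1) ^+ K.+1 * \prod_(i < m) (- y + i%:R).
have pS m : p m.+1 = p m * (m%:R - y).
  by rewrite /p big_ord_recr /= mulrA [- y + _]addrC.
have p_pos m : (K < m)%N -> 0 < p m.
  (* At [m = K.+1] all [K.+1] factors are negative and the sign cancels theirs; every later factor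
     is positive. *)
  elim: m => // m IHm; rewrite ltnS leq_eqVlt => /predU1P[<-|ltKm].
    rewrite /p -[X in _ ^+ X]card_ord -prodrN.
    apply: prodr_gt0 => i _; rewrite opprD opprK subr_gt0.
    by apply: le_lt_trans ltKy; rewrite ler_nat -ltnS.
  rewrite pS mulr_gt0 ?IHm // subr_gt0; apply: lt_le_trans ltyK _.
  by rewrite ler_nat.
(* [C] bounds each [p m] with [m <= K]. In [q], the 2 counts subsets, and [1 + y >= 1] lets its
   [n]-th power dominate [y ^+ (n - #|J|)] for all [J]. *)
pose C := \sum_(m < K.+1) `|p m|; pose q := 2 * (1 + y).
have C0 : 0 <= C by apply: sumr_ge0.
have q0 : 0 < q by rewrite mulr_gt0 // addr_gt0.
have bound_ge0 : 0 <= y + 2 * q by rewrite ltW // addr_gt0 // mulr_gt0.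
(* Beyond [M], [p] is positive and its growth factor [m%:R - y] is at least [2 * q]. *)
set M := maxn K.+1 (Num.bound (y + 2 * q)).
have [||N Npq] := geometric_lt_eventually (M := M) (u := p) q0 C0.
- by rewrite p_pos // leq_maxl.
- move=> n leMn; rewrite pS mulrC ler_wpM2l //.
    by rewrite ltW // p_pos // (leq_trans _ leMn) // leq_maxl.
  rewrite lerBrDr addrC; apply: le_trans (ltW (archi_boundP bound_ge0)) _.
  by rewrite ler_nat (leq_trans _ leMn) // leq_maxr.
exists N => n ltNn.
rewrite horner_derangement_poly ?(leq_ltn_trans _ ltNn) //.
rewrite sum_derangement_porbits ?oppr_eq0 ?gt_eqF // opprK mulr_sumr.
rewrite (bigD1 [set: 'I_n]) //= cardsT card_ord subnn mul1r -/(p n).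
rewrite -[ltLHS](subrr (C * q ^+ n)) ltr_leD ?Npq // 1?ltnW //.
have summand_ge (J : {set 'I_n}) :
    - (C * (1 + y) ^+ n) <=
    (-1) ^+ K.+1 * (y ^+ (n - #|J|) * \prod_(i < #|J|) (- y + i%:R)).
  rewrite mulrCA -/(p #|J|); have [ltKJ|leJK] := ltnP K #|J|.
    apply: (@le_trans _ _ 0); last by rewrite mulr_ge0 ?exprn_ge0 ?ltW ?p_pos.
    by rewrite oppr_le0 mulr_ge0 ?exprn_ge0 // addr_ge0 // ltW.
  apply: le_trans (lerNnormlW (lexx _)); rewrite lerN2 normrM mulrC.
  rewrite ler_pM //.
    rewrite /C (bigD1 (Ordinal (leJK : (#|J| < K.+1)%N))) //= lerDl.
    exact: sumr_ge0.
  rewrite ger0_norm ?exprn_ge0 ?(ltW y0) //.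
  apply: (@le_trans _ _ ((1 + y) ^+ (n - #|J|))).
    by rewrite lerXn2r ?nnegrE ?addr_ge0 ?lerDr ?ltW.
  by rewrite ler_weXn2l ?lerDl ?leq_subr // ltW.
apply: le_trans (ler_sum _ (fun J _ => summand_ge J)).
rewrite sumr_const mulNrn lerN2 -mulr_natl /q exprMn.
rewrite [leRHS]mulrCA ler_wpM2r //.
  by rewrite mulr_ge0 ?exprn_ge0 // addr_ge0 // ltW.
rewrite -natrX ler_nat (leq_trans (max_card _)) //.
by rewrite -cardsT -powersetT card_powerset cardsT card_ord.
Qed.

Theorem theorem2p3 (R : realType) (t : nat) (ht : (0 < t)%N)
    (eps : R) (heps : 0 < eps) :
  exists2 N : nat, (0 < N)%N &
    forall n : nat, (N < n)%N ->
      exists2 x : R, root (derangement_poly R n) x & `|- t%:R - x| < eps.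
Proof.
case: t ht => // t _.
(* With [d < 1], the points [t.+1 + d] and [t.+1 - d] lie in adjacent unit intervals, so the sign
   lemma applies with [K] equal to [t.+1] and [t]. *)
pose d := Num.min eps 1 / 2.
have d0 : 0 < d by rewrite divr_gt0 // lt_min heps ltr01.
have d_eps : d < eps.
  rewrite ltr_pdivrMr //; apply: (@le_lt_trans _ _ eps).
    by rewrite ge_min lexx.
  by rewrite ltr_pMr // ltr1n.
have d1 : d < 1.
  rewrite ltr_pdivrMr // mul1r; apply: (@le_lt_trans _ _ 1); last exact: ltr1n.
  by rewrite ge_min lexx orbT.
have [|Nl Hl] := @derangement_poly_sign R t.+1 (t.+1%:R + d).
  by rewrite ltrDl d0 -[t.+2%:R]natr1 ltrD2l.
have [|Nr Hr] := @derangement_poly_sign R t (t.+1%:R - d).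
  by rewrite gtrDl oppr_lt0 d0 -natr1 -addrA ltrDl subr_gt0 d1.
exists (maxn 1 (maxn Nl Nr)); first exact: leq_maxl.
move=> n; rewrite !gtn_max => /and3P[_ /Hl fl /Hr fr].
rewrite opprD in fl; rewrite opprB addrC in fr.
have ab : - t.+1%:R - d <= - t.+1%:R + d by rewrite lerD2l ge0_cp // ltW.
set f := derangement_poly R n in fl fr *.
(* The scaling makes the polynomial negative at the left end and positive at the right end, whatever
   the parity of [t]. *)
have [|x x_in] := @poly_ivt R ((-1) ^+ t.+1 *: f) _ _ ab.
  by rewrite !hornerZ (ltW fr) andbT -oppr_ge0 -mulNr -mulN1r -exprS ltW.
rewrite rootZ ?signr_eq0 // => fx; exists x => //.
by apply: le_lt_trans d_eps; rewrite distrC ler_distl.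
Qed.
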